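(* Let $(\mathcal{A}, G, \alpha)$ be a dynamical system and let $(\mathcal{D}, i)$ be an $\alpha$-admissible C*-cover for $\mathcal{A}$. Let $(\mathcal{C},j)$ be any C*-cover for $\mathcal{A}$ such that there exists a $*$-homomorphism $\pi$ of $\mathcal{D}$ onto $\mathcal{C}$ satisfying $\pi\circ i = j$ (i.e. $(\mathcal{C},j)\preceq(\mathcal{D},i)$). Then the following are equivalent: (1) $(\mathcal{C}, j)$ is $\alpha$-admissible. (2) $\ker \pi$ is an $\alpha$-invariant ideal in $\mathcal{D}$.
   Context: An (operator algebra) dynamical system $(\mathcal{A},G,\alpha)$ consists of an approximately unital (possibly non-self-adjoint) operator algebra $\mathcal{A}$ (approximately unital: having a contractive approximate identity), a locally compact Hausdorff group $G$, and a strongly continuous group representation $\alpha:G\to\mathrm{Aut}(\mathcal{A})$ such that each $\alpha_s$ is a completely isometric automorphism. A C*-cover for $\mathcal{A}$ is a pair $(\mathcal{C},j)$ where $\mathcal{C}$ is a C*-algebra and $j:\mathcal{A}\to\mathcal{C}$ is a completely isometric homomorphism with $\mathcal{C}=C^*(j(\mathcal{A}))$. A C*-cover $(\mathcal{C},j)$ is $\alpha$-admissible if there is a (necessarily unique) strongly continuous action $\tilde\alpha:G\to\mathrm{Aut}(\mathcal{C})$ by $*$-automorphisms with $\tilde\alpha_s\circ j=j\circ\alpha_s$ for all $s\in G$. If $(\mathcal{C},j)$ is $\alpha$-admissible, a closed two-sided ideal $J$ of $\mathcal{C}$ is called $\alpha$-invariant if $\tilde\alpha_s(J)\subseteq J$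 for all $s\in G$. *)

(* Defs.v *)
From HB Require Import structures.
From mathcomp Require Import all_boot all_order all_algebra.
From mathcomp Require Import complex.
From mathcomp Require Import all_classical all_reals all_analysis.

Set Implicit Arguments.
Unset Strict Implicit.
Unset Printing Implicit Defensive.

Import Order.TTheory GRing.Theory Num.Theory.
Import numFieldNormedType.Exports.

Local Open Scope classical_set_scope.
Local Open Scope ring_scope.

HB.mixin Record isTopologicalGroup G of Group G & Topological G := {
  mulg_continuous : continuous (fun p : G * G => (p.1 * p.2)%g);
  invg_continuous : continuous (fun s : G => (s^-1)%g)
}.

#[short(type="topologicalGroupType")]
HB.structure Definition TopologicalGroup :=
  {G of isTopologicalGroup G & Group G & Topological G}.

(* The complex scalars are R[i] with R : realType. *)

(* The norm `|x| of a vector of a normed space over R[i] is an element of R[i];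
   this is the same number as an element of R. *)
Definition rnorm (R : realType) (V : normedModType R[i]) (x : V) : R :=
  complex.Re `|x|.

(* Not assumed unital, unlike the algebras of MathComp. *)
HB.mixin Record isBanachAlgebra (R : realType) A
    of CompleteNormedModule R[i] A := {
  amul : A -> A -> A;
  amulA : associative amul;
  amulDl : left_distributive amul +%R;
  amulDr : right_distributive amul +%R;
  amulZl : forall (c : R[i]) (x y : A), amul (c *: x) y = c *: amul x y;
  amulZr : forall (c : R[i]) (x y : A), amul x (c *: y) = c *: amul x y;
  norm_amul_le : forall x y : A, `|amul x y| <= `|x| * `|y|
}.

#[short(type="banachAlgType")]
HB.structure Definition BanachAlgebra (R : realType) :=
  {A of isBanachAlgebra R A & CompleteNormedModule R[i] A}.

Arguments amul {R A} : rename.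

HB.mixin Record isCstarAlgebra (R : realType) C of BanachAlgebra R C := {
  astar : C -> C;
  astarK : involutive astar;
  astarD : forall x y : C, astar (x + y) = astar x + astar y;
  astarZ : forall (c : R[i]) (x : C), astar (c *: x) = c^* *: astar x;
  astarM : forall x y : C, astar (amul x y) = amul (astar y) (astar x);
  cstar_identity : forall x : C, `|amul (astar x) x| = `|x| ^+ 2
}.

#[short(type="cstarAlgType")]
HB.structure Definition CstarAlgebra (R : realType) :=
  {C of isCstarAlgebra R C & BanachAlgebra R C}.

Arguments astar {R C} : rename.

HB.mixin Record isHilbert (R : realType) H of CompleteNormedModule R[i] H := {
  hdot : H -> H -> R[i];
  hdotDl : forall x y z : H, hdot (x + y) z = hdot x z + hdot y z;
  hdotZl : forall (c : R[i]) (x y : H), hdot (c *: x) y = c * hdot x y;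
  hdotC : forall x y : H, hdot y x = (hdot x y)^*;
  hdot_norm : forall x : H, hdot x x = `|x| ^+ 2
}.

#[short(type="hilbertType")]
HB.structure Definition Hilbert (R : realType) :=
  {H of isHilbert R H & CompleteNormedModule R[i] H}.

(* The norm of the n-fold Hilbert sum H^n. *)
Definition hsum_norm (R : realType) (H : hilbertType R) n
    (x : 'I_n -> H) : R :=
  Num.sqrt (\sum_i rnorm (x i) ^+ 2).

(* Operator norms are extended real suprema, so that they are +oo on unbounded
   operators. *)
Definition opnorm (R : realType) (H : hilbertType R) (T : H -> H) : \bar R :=
  ereal_sup [set (rnorm (T x))%:E | x in [set x | rnorm x <= 1]].

(* The norm of the operator matrix T, acting on H^n. *)
Definition mxopnorm (R : realType) (H : hilbertType R) n
    (T : 'I_n -> 'I_n -> H -> H) : \bar R :=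
  ereal_sup [set (hsum_norm (fun k => \sum_l T k l (x l)))%:E |
             x in [set x : 'I_n -> H | hsum_norm x <= 1]].

(* An operator algebra, i.e. a norm-closed subalgebra of B(H), is given as a
   Banach algebra A together with an isometric homomorphism oprep of A into
   B(H); the completeness of A amounts to the closedness of the image. *)
HB.mixin Record isOperatorAlgebra (R : realType) A of BanachAlgebra R A := {
  ophilbert : hilbertType R;
  oprep : A -> ophilbert -> ophilbert;
  oprep_linear : forall a : A, linear (oprep a);
  oprepD : forall (a b : A) x, oprep (a + b) x = oprep a x + oprep b x;
  oprepZ : forall (c : R[i]) (a : A) x, oprep (c *: a) x = c *: oprep a x;
  oprepM : forall (a b : A) x, oprep (amul a b) x = oprep a (oprep b x);
  oprep_isometric : forall a : A, opnorm (oprep a) = (rnorm a)%:E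
}.

#[short(type="operatorAlgType")]
HB.structure Definition OperatorAlgebra (R : realType) :=
  {A of isOperatorAlgebra R A & BanachAlgebra R A}.

(* The norm of M_n(A) inherited from B(H^n). *)
Definition mxnorm_op (R : realType) (A : operatorAlgType R) n
    (M : 'M[A]_n) : \bar R :=
  mxopnorm (fun k l => oprep (M k l)).

(* MathComp's matrix product needs entries in a unital ring. *)
Definition mxamul (R : realType) (A : banachAlgType R) n
    (M N : 'M[A]_n) : 'M[A]_n :=
  \matrix_(k, l) \sum_m amul (M k m) (N m l).

Definition mxastar (R : realType) (C : cstarAlgType R) n
    (M : 'M[C]_n) : 'M[C]_n :=
  \matrix_(k, l) astar (M l k).

(* N is the (unique) norm for which the *-algebra M_n(C) is a C*-algebra. *)
Definition is_cstar_mxnorm (R : realType) (C : cstarAlgType R) n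
    (N : 'M[C]_n -> R) : Prop :=
  exists (B : cstarAlgType R) (Phi : 'M[C]_n -> B),
    bijective Phi /\
    [/\ forall M M' : 'M[C]_n, Phi (M + M') = Phi M + Phi M',
        forall (c : R[i]) (M : 'M[C]_n),
          Phi (map_mx (fun x => c *: x) M) = c *: Phi M,
        forall M M' : 'M[C]_n, Phi (mxamul M M') = amul (Phi M) (Phi M'),
        forall M : 'M[C]_n, Phi (mxastar M) = astar (Phi M)
      & forall M : 'M[C]_n, N M = rnorm (Phi M)].

Definition alg_hom (R : realType) (A B : banachAlgType R) (f : A -> B) : Prop :=
  linear f /\ forall x y, f (amul x y) = amul (f x) (f y).

Definition star_hom (R : realType) (C D : cstarAlgType R)
    (f : C -> D) : Prop :=
  alg_hom f /\ forall x, f (astar x) = astar (f x).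

Definition ci_automorphism (R : realType) (A : operatorAlgType R)
    (f : A -> A) : Prop :=
  [/\ alg_hom f, bijective f
    & forall n (M : 'M[A]_n), mxnorm_op (map_mx f M) = mxnorm_op M].

Definition star_automorphism (R : realType) (C : cstarAlgType R)
    (f : C -> C) : Prop :=
  star_hom f /\ bijective f.

Definition approximately_unital (R : realType) (A : banachAlgType R) : Prop :=
  exists (I : Type) (F : set_system I) (e : I -> A),
    [/\ ProperFilter F, forall k, `|e k| <= 1,
        forall a : A, amul (e k) a @[k --> F] --> a
      & forall a : A, amul a (e k) @[k --> F] --> a].

Definition strongly_continuous_rep (R : realType) (G : topologicalGroupType)
    (V : normedModType R[i]) (alpha : G -> V -> V) : Prop :=
  [/\ forall x, alpha 1%g x = x,
      forall s t x, alpha (s * t)%g x = alpha s (alpha t x)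
    & forall x, continuous (fun s => alpha s x)].

Definition dynamical_system (R : realType) (A : operatorAlgType R)
    (G : topologicalGroupType) (alpha : G -> A -> A) : Prop :=
  [/\ approximately_unital A, hausdorff_space G, locally_compact [set: G],
      strongly_continuous_rep alpha
    & forall s, ci_automorphism (alpha s)].

Definition cstar_subalgebra (R : realType) (C : cstarAlgType R)
    (S : set C) : Prop :=
  closed S /\
  [/\ S 0, forall x y, S x -> S y -> S (x + y),
      forall (c : R[i]) x, S x -> S (c *: x),
      forall x y, S x -> S y -> S (amul x y)
    & forall x, S x -> S (astar x)].

Definition cstar_generated (R : realType) (C : cstarAlgType R)
    (S : set C) : set C :=
  smallest (@cstar_subalgebra R C) S.

Definition completely_isometric (R : realType) (A : operatorAlgType R)
    (C : cstarAlgType R) (j : A -> C) : Prop :=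
  forall n, exists N : 'M[C]_n -> R,
    is_cstar_mxnorm N /\
    forall M : 'M[A]_n, (N (map_mx j M))%:E = mxnorm_op M.

Definition cstar_cover (R : realType) (A : operatorAlgType R)
    (C : cstarAlgType R) (j : A -> C) : Prop :=
  [/\ alg_hom j, completely_isometric j
    & cstar_generated (range j) = [set: C]].

Definition cover_action (R : realType) (A : operatorAlgType R)
    (G : topologicalGroupType) (alpha : G -> A -> A) (C : cstarAlgType R)
    (j : A -> C) (beta : G -> C -> C) : Prop :=
  [/\ strongly_continuous_rep beta, forall s, star_automorphism (beta s)
    & forall s a, beta s (j a) = j (alpha s a)].

Definition admissible (R : realType) (A : operatorAlgType R)
    (G : topologicalGroupType) (alpha : G -> A -> A) (C : cstarAlgType R)
    (j : A -> C) : Prop :=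
  exists beta : G -> C -> C, cover_action alpha j beta.

Definition closed_ideal (R : realType) (C : cstarAlgType R)
    (J : set C) : Prop :=
  closed J /\
  [/\ J 0, forall x y, J x -> J y -> J (x + y),
      forall (c : R[i]) x, J x -> J (c *: x),
      forall x y, J x -> J (amul y x)
    & forall x y, J x -> J (amul x y)].

(* beta is meant to be the action on C that extends alpha. *)
Definition invariant_ideal (R : realType) (G : topologicalGroupType)
    (C : cstarAlgType R) (beta : G -> C -> C) (J : set C) : Prop :=
  closed_ideal J /\ forall s, beta s @` J `<=` J.

(* Main.v *)
Require Import Defs.
From mathcomp Require Import all_boot all_order all_algebra.
From mathcomp Require Import complex.
From mathcomp Require Import all_classical all_reals all_analysis.

Import Order.TTheory GRing.Theory Num.Theory numFieldNormedType.Exports.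

Local Open Scope classical_set_scope.
Local Open Scope ring_scope.

(** The only analytic ingredient of the theorem is that a *-homomorphism f
    between C*-algebras is continuous; everything else is formal.

    Continuity is obtained without spectral theory and without unitizations.
    Call x quasi-unitary if x* x = - (x + x* ), that is, if 1 + x would be an
    isometry in a unitization.  The C*-identity gives
    |x|^2 = |x + x*| <= 2 |x|, hence |x| <= 2, and this algebraic condition is
    preserved by f.  A self-adjoint h with |h| <= 1/2 is the imaginary part of
    such an element: 1 - k, with k = 1 - sqrt (1 - h^2), completes h to
    the unitary 1 + w = (1 - k) + i h.  The element k is the fixed point of the
    contraction k |-> (h^2 + k^2) / 2 [quasisqrt_exists].  Hence
    2 |f h| = |f w - (f w)*| <= 4 [star_hom_selfadjoint_le2], and the
    C*-identity passes from h = x* x to an arbitrary x [star_hom_norm_le].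

    If beta is an action on C extending alpha, then pi o alphaD_s and
    beta_s o pi are *-homomorphisms that agree on i(A).  By continuity they
    agree on the C*-algebra generated by i(A), which is D
    [star_hom_eq_on_generators], so alphaD_s preserves ker pi.  Conversely,
    when ker pi is invariant, alphaD descends along the surjection pi
    [quotient_action]; the orbit maps of the quotient action are the orbit maps
    of alphaD followed by pi, so they are continuous because pi is. *)

(** * Normed spaces over the complex numbers *)

Lemma lipschitz_maps_continuous (K : numFieldType) (V W : normedModType K)
    (f : V -> W) (M : K) :
  0 < M -> (forall x y, `|f x - f y| <= M * `|x - y|) -> continuous f.
Proof.
move=> M0 fM x; apply/cvgrPdist_lt => e e0.
near=> y; apply: le_lt_trans (fM x y) _.
rewrite -ltr_pdivlMl// mulrC.
near: y; apply: cvgr_dist_lt => //.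
by rewrite divr_gt0.
Unshelve. all: by end_near. Qed.

Lemma closed_coincidence (T : topologicalType) (K : numFieldType)
    (V : normedModType K) (f g : T -> V) :
  continuous f -> continuous g -> closed [set x | f x = g x].
Proof.
move=> fc gc.
have -> : [set x | f x = g x] = (fun x => f x - g x) @^-1` [set 0].
  by apply/seteqP; split=> x /= => [->|/subr0_eq //]; rewrite subrr.
apply: closed_comp => [x _|]; first by apply: cvgB; [exact: fc|exact: gc].
apply: accessible_closed_set1.
exact/hausdorff_accessible/norm_hausdorff.
Qed.

Lemma closed_norm_le (K : numFieldType) (V : normedModType K) (c : K) :
  0 <= c -> closed [set x : V | `|x| <= c].
Proof.
move=> c0 x xcl /=.
apply/ler_addgt0Pr => e e0.
have [y [/= yc]] := xcl _ (nbhsx_ballx x e e0).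
rewrite -ball_normE /= => xy.
rewrite -(subrK y x) addrC; apply: le_trans (ler_normD _ _) _.
by rewrite lerD// ltW.
Qed.

(** The order of [R[i]] is only partial, but a positive element is real, so
    this reduces to the archimedean property of [R]. *)
Lemma expr_half_lt (R : realType) (e : R[i]) :
  0 < e -> exists n, (2^-1 : R[i]) ^+ n < e.
Proof.
move=> e0.
have eE : e = (complex.Re e)%:C%C by rewrite RRe_real// gtr0_real.
have r0 : 0 < complex.Re e by move: e0; rewrite {1}eE ltcR.
have [N _ /(_ N (leqnn N))] := near_infty_natSinv_expn_lt (PosNum r0).
rewrite /= => H; exists N; rewrite eE.
have -> : (2^-1 : R[i]) ^+ N = ((1 / 2 ^+ N) : R)%:C%C.
  by rewrite div1r -exprVn rmorphXn fmorphV rmorph_nat.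
by rewrite ltcR.
Qed.

(** Banach's fixed point theorem for scalars in [R[i]].  As [P] has diameter at
    most 1, iterating the contraction gives |u_n - u_(n+m)| <= 2^-n at once,
    with no geometric series. *)
Lemma half_contraction_fixpoint (R : realType) (V : completeNormedModType R[i])
    (P : set V) (phi : V -> V) (x0 : V) :
  closed P -> P x0 -> (forall x, P x -> P (phi x)) ->
  (forall x y, P x -> P y -> `|x - y| <= 1) ->
  (forall x y, P x -> P y -> `|phi x - phi y| <= 2^-1 * `|x - y|) ->
  exists2 x, P x & phi x = x.
Proof.
move=> Pcl P0 Pphi Pdiam Pctr.
pose u n := iter n phi x0.
have Pu n : P (u n) by elim: n => //= n; exact: Pphi.
have ud n m : `|u n - u (n + m)%N| <= 2^-1 ^+ n.
  elim: n => [|n IH]; first by rewrite expr0; exact: Pdiam.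
  rewrite addSn exprS; apply: le_trans (Pctr _ _ (Pu _) (Pu _)) _.
  by rewrite ler_pM2l.
have h1 : (2^-1 : R[i]) <= 1 by rewrite invf_le1// ler1n.
have ud2 N n m : (N <= n)%N -> (N <= m)%N -> `|u n - u m| <= 2^-1 ^+ N.
  wlog nm : n m / (n <= m)%N => [W Nn Nm|Nn _].
    by case/orP: (leq_total n m) => /W; last rewrite distrC; apply.
  rewrite -(subnKC nm); apply: le_trans (ud _ _) _.
  by apply: ler_wiXn2l.
have ucvg : cvgn u.
  apply: cauchy_cvg; apply: cauchy_exP => e e0.
  have [N Ne] := expr_half_lt _ _ e0.
  exists (u N); exists N => // n /= Nn; rewrite -ball_normE /=.
  exact: le_lt_trans (ud2 _ _ _ (leqnn N) Nn) Ne.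
have Pl : P (limn u) by apply: closed_cvg ucvg => //; apply: nearW.
exists (limn u) => //.
have c1 : u n.+1 @[n --> \oo] --> limn u by rewrite cvg_shiftS.
apply: cvg_unique c1 => //.
apply/cvgrPdist_lt => e e0; near=> n.
apply: le_lt_trans (Pctr _ _ Pl (Pu n)) _.
apply: (@le_lt_trans _ _ (`|limn u - u n|)).
  by rewrite ler_piMl.
by near: n; move/cvgrPdist_lt: ucvg; apply.
Unshelve. all: by end_near. Qed.

(** * Arithmetic and continuity in Banach algebras and C*-algebras *)

Section BanachAlgebra.
Context {R : realType} {A : banachAlgType R}.
Implicit Types x y z : A.

Lemma amulNl x y : amul (- x) y = - amul x y.
Proof. by rewrite -scaleN1r amulZl scaleN1r. Qed.

Lemma amulNr x y : amul x (- y) = - amul x y.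
Proof. by rewrite -scaleN1r amulZr scaleN1r. Qed.

Lemma amulBl x y z : amul (x - y) z = amul x z - amul y z.
Proof. by rewrite amulDl amulNl. Qed.

Lemma amulBr x y z : amul x (y - z) = amul x y - amul x z.
Proof. by rewrite amulDr amulNr. Qed.

Lemma amul0l x : amul 0 x = 0.
Proof. by rewrite -{1}(scale0r x) amulZl scale0r. Qed.

Lemma amul0r x : amul x 0 = 0.
Proof. by rewrite -{1}(scale0r x) amulZr scale0r. Qed.

Lemma amull_continuous x : continuous (amul x).
Proof.
apply: (@lipschitz_maps_continuous _ _ _ _ (`|x| + 1)) => [|y z].
  by rewrite ltr_wpDl.
rewrite -amulBr; apply: le_trans (norm_amul_le _ _) _.
by rewrite ler_wpM2r// lerDl.
Qed.

Lemma amulr_continuous x : continuous (amul^~ x).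
Proof.
apply: (@lipschitz_maps_continuous _ _ _ _ (`|x| + 1)) => [|y z].
  by rewrite ltr_wpDl.
rewrite -amulBl; apply: le_trans (norm_amul_le _ _) _.
by rewrite mulrC ler_wpM2r// lerDl.
Qed.

End BanachAlgebra.

Section CstarAlgebra.
Context {R : realType} {C : cstarAlgType R}.
Implicit Types x y h k : C.

Lemma astarN x : astar (- x) = - astar x.
Proof. by rewrite -scaleN1r astarZ rmorphN rmorph1 scaleN1r. Qed.

Lemma astarB x y : astar (x - y) = astar x - astar y.
Proof. by rewrite astarD astarN. Qed.

Lemma astar0 : astar (0 : C) = 0.
Proof. by rewrite -{1}(subrr (0 : C)) astarB subrr. Qed.

Lemma norm_astar_ge x : `|x| <= `|astar x|.
Proof.
have [->|x0] := eqVneq x 0; first by rewrite normr0.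
have := norm_amul_le (astar x) x.
by rewrite cstar_identity expr2 ler_pM2r// normr_gt0.
Qed.

Lemma norm_astar x : `|astar x| = `|x|.
Proof.
by apply/le_anti; rewrite norm_astar_ge -{2}(astarK x) norm_astar_ge.
Qed.

Lemma astar_continuous : continuous (@astar R C).
Proof.
apply: (@lipschitz_maps_continuous _ _ _ _ 1) => // x y.
by rewrite -astarB norm_astar mul1r.
Qed.

(** The hypothesis says that (1 + x)* (1 + x) = 1 in a unitization.  It bounds
    |x|^2 = |x* x| = |x + x*| by 2 |x|. *)
Lemma norm_quasiunitary_le2 x :
  amul (astar x) x = - (x + astar x) -> `|x| <= 2.
Proof.
move=> xq; have [->|x0] := eqVneq x 0; first by rewrite normr0.
have := cstar_identity x; rewrite xq normrN => xE.
have := ler_normD x (astar x).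
by rewrite xE norm_astar expr2 -mulr2n -[leRHS]mulr_natl ler_pM2r// normr_gt0.
Qed.

(** The equation says that h^2 + (1 - k)^2 = 1, so k plays the part of
    1 - sqrt (1 - h^2).  It is a fixed point of k |-> (h^2 + k^2) / 2, which
    maps the ball of radius 1/2 to itself and is 1/2-Lipschitz there, since
    x^2 - y^2 = x (x - y) + (x - y) y.  Iteration also preserves
    self-adjointness and commutation with h, both closed conditions. *)
Lemma quasisqrt_exists h : astar h = h -> `|h| <= 2^-1 ->
  exists k, [/\ astar k = k, amul h k = amul k h
              & k + k = amul h h + amul k k].
Proof.
move=> hs hle.
pose P := [set k : C | `|k| <= 2^-1] `&`
          ([set k | astar k = k] `&` [set k | amul h k = amul k h]).
have Pcl : closed P.
  apply: closedI.
    exact: closed_norm_le.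
  apply: closedI.
    apply: (closed_coincidence _ _ _ _ id astar_continuous) => x.
    exact: cvg_id.
  apply: closed_coincidence; first exact: amull_continuous.
  exact: amulr_continuous.
have half2 : 2^-1 + 2^-1 = 1 :> R[i] by rewrite [RHS]splitr !mul1r.
pose phi k : C := 2^-1 *: (amul h h + amul k k).
have sq2 (x : C) : `|x| <= 2^-1 -> `|amul x x| <= 2^-1 * 2^-1.
  by move=> xl; apply: le_trans (norm_amul_le _ _) _; rewrite ler_pM.
have hn : `|2^-1 : R[i]| = 2^-1 by rewrite ger0_norm.
have [||||k [_ [ks kh]] kfix] :=
    @half_contraction_fixpoint R C P phi 0 Pcl.
- by split=> /=; [rewrite normr0 | rewrite astar0 amul0l amul0r].
- move=> k [/= kle [ks kh]]; split=> /=; last split.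
  + rewrite /phi normrZ hn ler_piMr//.
    apply: le_trans (ler_normD _ _) _.
    apply: le_trans (lerD (sq2 _ hle) (sq2 _ kle)) _.
    by rewrite -mulrDl half2 mul1r invf_le1// ler1n.
  + by rewrite /phi astarZ astarD !astarM hs ks fmorphV rmorph_nat.
  + rewrite /phi amulZl amulZr amulDl amulDr !amulA kh.
    by rewrite -(amulA k h) kh !amulA.
- move=> x y [/= xle _] [/= yle _].
  apply: le_trans (ler_normB _ _) _.
  by rewrite (le_trans (lerD xle yle))// half2.
- move=> x y [/= xle _] [/= yle _].
  have -> : phi x - phi y = 2^-1 *: (amul x (x - y) + amul (x - y) y).
    rewrite /phi -scalerBr amulBr amulBl; congr (_ *: _).
    by rewrite opprD addrACA subrr add0r subrKA.
  rewrite normrZ hn ler_wpM2l//.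
  apply: le_trans (ler_normD _ _) _.
  rewrite (le_trans (lerD (norm_amul_le _ _) (norm_amul_le _ _)))//.
  rewrite (mulrC `|x - y|) -mulrDl ler_piMl//.
  by rewrite (le_trans (lerD xle yle))// half2.
exists k; split=> //.
rewrite -{1 2}kfix /phi -scalerDl.
by rewrite half2 scale1r.
Qed.

End CstarAlgebra.

(** * Automatic continuity of *-homomorphisms *)

Section AlgHom.
Context {R : realType} {A B : banachAlgType R} {f : A -> B}.
Hypothesis fhom : alg_hom f.

Lemma alg_homZ c x : f (c *: x) = c *: f x.
Proof.
have f0 : f 0 = 0.
  by have := fhom.1 (-1) 0 0; rewrite scaler0 addr0 scaleN1r addNr.
by have := fhom.1 c x 0; rewrite f0 !addr0.
Qed.

Lemma alg_homD x y : f (x + y) = f x + f y.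
Proof. by have := fhom.1 1 x y; rewrite !scale1r. Qed.

Lemma alg_hom0 : f 0 = 0.
Proof. by rewrite -{1}(scale0r 0) alg_homZ scale0r. Qed.

Lemma alg_homN x : f (- x) = - f x.
Proof. by rewrite -scaleN1r alg_homZ scaleN1r. Qed.

Lemma alg_homB x y : f (x - y) = f x - f y.
Proof. by rewrite alg_homD alg_homN. Qed.

End AlgHom.

Section StarHom.
Context {R : realType} {C D : cstarAlgType R} {f : C -> D}.
Hypothesis fhom : star_hom f.

(** With k from [quasisqrt_exists], w = i h - k is quasi-unitary and
    w - w* = 2 i h.  Both relations are algebraic, so f transports them, and
    [norm_quasiunitary_le2] bounds f w regardless of the size of f. *)
Lemma star_hom_selfadjoint_le2 h :
  astar h = h -> `|h| <= 2^-1 -> `|f h| <= 2.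
Proof.
move=> hs hle; have [k [ks hk kk]] := quasisqrt_exists h hs hle.
pose a := 'i *: h; pose w := a - k.
have ak : amul a k = amul k a by rewrite amulZl amulZr hk.
have aa : amul a a = - amul h h.
  by rewrite amulZl amulZr scalerA -expr2 sqrCi scaleN1r.
have ws : astar w = - a - k.
  by rewrite astarB astarZ hs ks conjCi scaleNr.
have wq : amul (astar w) w = - (w + astar w).
  rewrite ws amulBl amulNl !amulBr ak aa opprB opprK.
  rewrite [RHS](_ : _ = k + k); last first.
    by rewrite addrACA subrr add0r opprD opprK.
  by rewrite kk opprB addrC addrA subrK addrC.
have fwq : amul (astar (f w)) (f w) = - (f w + astar (f w)).
  by rewrite -!fhom.2 -fhom.1.2 wq (alg_homN fhom.1) (alg_homD fhom.1).
have wh : f w - astar (f w) = (2 * 'i) *: f h.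
  rewrite -fhom.2 ws -(alg_homB fhom.1) -(alg_homZ fhom.1); congr f.
  by rewrite -opprD opprK (addrC a k) subrKA -mulr2n -scaler_nat scalerA.
have : `|(2 * 'i) *: f h| <= 2 * 2.
  rewrite -wh; apply: le_trans (ler_normB _ _) _.
  by rewrite norm_astar mulr_natl mulr2n lerD// norm_quasiunitary_le2.
rewrite normrZ normrM normCi mulr1 ger0_norm//.
by rewrite ler_pM2l.
Qed.

(** The bound for self-adjoint elements extends by |f x|^2 = |f (x* x)|.
    The constant 4 is not sharp, but any bound gives continuity. *)
Lemma star_hom_norm_le x : `|f x| <= 4 * `|x|.
Proof.
have small z : `|z| <= 2^-1 -> `|f z| <= 2.
  move=> zle.
  have : `|f z| ^+ 2 <= 2 ^+ 2.
    rewrite -cstar_identity -fhom.2 -fhom.1.2.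
    apply: (@le_trans _ _ 2); last by rewrite expr2 ler_peMl// ler1n.
    apply: star_hom_selfadjoint_le2; first by rewrite astarM astarK.
    rewrite cstar_identity expr2 (le_trans _ zle)// ler_piMl//.
    by rewrite (le_trans zle)// invf_le1// ler1n.
  by rewrite ler_pXn2r// nnegrE.
have [->|x0] := eqVneq x 0; first by rewrite (alg_hom0 fhom.1) !normr0 mulr0.
have n0 : 0 < `|x| by rewrite normr_gt0.
have c0 : 0 < (2 * `|x|)^-1 by rewrite invr_gt0 mulr_gt0.
(* Rescale x to the boundary of the ball on which f is bounded by 2. *)
have nc : `|(2 * `|x|)^-1 *: x| = 2^-1.
  by rewrite normrZ gtr0_norm// invfM -mulrA mulVf ?mulr1// gt_eqF.
have := small ((2 * `|x|)^-1 *: x).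
rewrite nc (alg_homZ fhom.1) normrZ gtr0_norm// ler_pdivrMl ?mulr_gt0//.
by move=> /(_ (lexx _)); rewrite mulrAC -natrM.
Qed.

Lemma star_hom_continuous : continuous f.
Proof.
apply: (@lipschitz_maps_continuous _ _ _ _ 4) => // x y.
by rewrite -(alg_homB fhom.1) star_hom_norm_le.
Qed.

Lemma star_hom_kernel_closed_ideal : closed_ideal [set x | f x = 0].
Proof.
have f0 := alg_hom0 fhom.1; split.
  apply: (closed_coincidence _ _ _ f (fun=> 0) star_hom_continuous).
  by move=> x; exact: cvg_cst.
split=> //=.
- by move=> x y fx fy; rewrite (alg_homD fhom.1) fx fy addr0.
- by move=> c x fx; rewrite (alg_homZ fhom.1) fx scaler0.
- by move=> x y fx; rewrite fhom.1.2 fx amul0r.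
- by move=> x y fx; rewrite fhom.1.2 fx amul0l.
Qed.

End StarHom.

(** * Descending an action along a surjective *-homomorphism *)

Lemma star_hom_comp (R : realType) (B C D : cstarAlgType R)
    (f : B -> C) (g : C -> D) :
  star_hom f -> star_hom g -> star_hom (g \o f).
Proof.
move=> [[fl fm] fs] [[gl gm] gs]; split; first split.
- by move=> c x y /=; rewrite fl gl.
- by move=> x y /=; rewrite fm gm.
- by move=> x /=; rewrite fs gs.
Qed.

(** The coincidence set of f and g is a *-subalgebra; it is closed because
    *-homomorphisms are continuous. *)
Lemma star_hom_eq_on_generators (R : realType) (C D : cstarAlgType R)
    (f g : C -> D) (S : set C) :
  star_hom f -> star_hom g -> cstar_generated S = [set: C] ->
  (forall x, S x -> f x = g x) -> f =1 g.
Proof.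
move=> fh gh Sgen fg x.
have : cstar_generated S x by rewrite Sgen.
move=> /(_ [set y | f y = g y]); apply; split; last exact: fg.
split; first by apply: closed_coincidence; exact: star_hom_continuous.
split=> /=.
- by rewrite (alg_hom0 fh.1) (alg_hom0 gh.1).
- by move=> y z fy fz; rewrite (alg_homD fh.1) (alg_homD gh.1) fy fz.
- by move=> c y fy; rewrite (alg_homZ fh.1) (alg_homZ gh.1) fy.
- by move=> y z fy fz; rewrite fh.1.2 gh.1.2 fy fz.
- by move=> y fy; rewrite fh.2 gh.2 fy.
Qed.

(** The action on C is beta_s (pi x) = pi (alphaD_s x), which is well defined
    by the invariance of ker pi.  The algebraic identities descend since pi is
    onto. *)
Lemma quotient_action (R : realType) (G : topologicalGroupType)
    (C D : cstarAlgType R) (alphaD : G -> D -> D) (pi : D -> C) :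
  strongly_continuous_rep alphaD -> (forall s, star_automorphism (alphaD s)) ->
  star_hom pi -> range pi = [set: C] ->
  (forall s x, pi x = 0 -> pi (alphaD s x) = 0) ->
  exists beta : G -> C -> C,
    [/\ strongly_continuous_rep beta, forall s, star_automorphism (beta s)
      & forall s x, beta s (pi x) = pi (alphaD s x)].
Proof.
move=> [a1 aM ac] aut pih onto inv.
have [c|g gK] := @choice C D (fun c x => pi x = c).
  by have [x _ <-] : range pi c by [rewrite onto]; exists x.
pose beta s c := pi (alphaD s (g c)).
have betaE s x : beta s (pi x) = pi (alphaD s x).
  have [[ahom _] _] := aut s; apply: subr0_eq.
  rewrite -(alg_homB pih.1) -(alg_homB ahom); apply: inv.
  by rewrite (alg_homB pih.1) gK subrr.
have beta1 c : beta 1%g c = c by rewrite -(gK c) betaE a1.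
have betaM s t c : beta (s * t)%g c = beta s (beta t c).
  by rewrite -(gK c) !betaE aM.
exists beta; split=> //.
- split=> // c s; apply: continuous_comp; first exact: ac.
  exact: star_hom_continuous.
- move=> s; have [ah _] := aut s; split.
    split; first split.
    + move=> k x y; rewrite -(gK x) -(gK y) -pih.1.1 !betaE.
      by rewrite ah.1.1 pih.1.1.
    + move=> x y; rewrite -(gK x) -(gK y) -pih.1.2 !betaE.
      by rewrite ah.1.2 pih.1.2.
    + by move=> x; rewrite -(gK x) -pih.2 !betaE ah.2 pih.2.
  by exists (beta s^-1%g) => c; rewrite -betaM (mulVg, mulgV) beta1.
Qed.

Theorem theorem3p9 (R : realType) (A : operatorAlgType R)
    (G : topologicalGroupType) (alpha : G -> A -> A)
    (D : cstarAlgType R) (i : A -> D) (alphaD : G -> D -> D)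
    (C : cstarAlgType R) (j : A -> C) (pi : D -> C)
    (hA : dynamical_system alpha)
    (hD : cstar_cover i) (hDadm : cover_action alpha i alphaD)
    (hC : cstar_cover j)
    (hpi : star_hom pi) (hpi_onto : range pi = [set: C])
    (hpij : forall a : A, pi (i a) = j a) :
  admissible alpha j <-> invariant_ideal alphaD [set x : D | pi x = 0].
Proof.
have [arep aaut ai] := hDadm; split=> [[beta [_ baut bj]]|[_ inv]].
  split; first exact: star_hom_kernel_closed_ideal.
  move=> s _ [x /= pix <-].
  have [ah _] := aaut s; have [bh _] := baut s; have [_ _ igen] := hD.
  have eqv : pi \o alphaD s =1 beta s \o pi.
    apply: (star_hom_eq_on_generators _ _ _ _ _ _ _ _ igen).
    - exact: star_hom_comp.
    - exact: star_hom_comp.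
    - by move=> _ [a _ <-] /=; rewrite ai !hpij bj.
  by have /= -> := eqv x; rewrite pix (alg_hom0 bh.1).
have [|beta [brep baut bpi]] :=
    quotient_action _ _ _ _ _ _ arep aaut hpi hpi_onto.
  by move=> s x pix; apply: (inv s); exists x.
exists beta; split=> // s a.
by rewrite -!hpij bpi ai.
Qed.
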